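(* Let $\mathfrak f\colon\mathfrak R\to\mathfrak S$ be a strongly right taut continuous map of complete, separated two-sided linear topological rings with countable bases of neighborhoods of zero. Then the following two conditions are equivalent: (1) the functor of restriction of scalars $\mathfrak f_\sharp\colon\mathfrak S\text{-}\mathsf{Separ}\to\mathfrak R\text{-}\mathsf{Separ}$ is fully faithful; (2) $\mathfrak f$ is a topological ring proepimorphism.
   Context: All rings are associative and unital, and ring maps are unital ring homomorphisms. A topological ring is two-sided linear if open two-sided ideals form a base of neighborhoods of zero; it is complete and separated if the natural map to the projective limit of its quotients by all open subgroups is bijective. For a ring map $\mathfrak f\colon\mathfrak R\to\mathfrak S$ and $\mathfrak I\subset\mathfrak R$, $\mathfrak f(\mathfrak I)\mathfrak S$ is the right ideal generated by $\mathfrak f(\mathfrak I)$. The map $\mathfrak f$ is strongly right taut if those open two-sided ideals $\mathfrak I\subset\mathfrak R$ for which the closure of $\mathfrak f(\mathfrak I)\mathfrak S$ in $\mathfrak S$ is an open two-sided ideal of $\mathfrak S$ form a base of neighborhoods of zero in $\mathfrak R$. A continuous $\mathfrak f$ is a topological ring proepimorphism if, for all open two-sided ideals $\mathfrak I\subset\mathfrak R$ and $\mathfrak J\subset\mathfrak S$ with $\mathfrak f(\mathfrak I)\subset\mathfrak J$, the induced map $\mathfrak R/\mathfrak I\to\mathfrak S/\mathfrak J$ is an epimorphism in the category of associative unital rings. Contramodules. For a set $X$, let $\mathfrak R[[X]]$ be the set of all infinite formal linear combinations $\sum_{x\in X}r_xx$ whose coefficient families $(r_x\in\mathfrak R)_{x\in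 X}$ converge to zero (for every open subgroup $\mathfrak U\subset\mathfrak R$, $r_x\in\mathfrak U$ for all but finitely many $x$). A map $g\colon X\to Y$ induces $\mathfrak R[[g]]\colon\sum_x r_xx\mapsto\sum_y\bigl(\sum_{g(x)=y}r_x\bigr)y$, where infinite sums in $\mathfrak R$ are limits of finite partial sums. The functor $\mathfrak R[[-]]$ is a monad on sets with unit $\epsilon_X\colon x\mapsto 1\cdot x$ and multiplication $\phi_X\colon\mathfrak R[[\mathfrak R[[X]]]]\to\mathfrak R[[X]]$ given by opening parentheses. A left $\mathfrak R$-contramodule is a module (algebra) over this monad, i.e. a set $\mathfrak P$ with a map $\pi_{\mathfrak P}\colon\mathfrak R[[\mathfrak P]]\to\mathfrak P$ satisfying $\pi_{\mathfrak P}\epsilon_{\mathfrak P}=\mathrm{id}$ and $\pi_{\mathfrak P}\circ\mathfrak R[[\pi_{\mathfrak P}]]=\pi_{\mathfrak P}\circ\phi_{\mathfrak P}$. These form an abelian category $\mathfrak R\text{-}\mathsf{Contra}$; restricting $\pi_{\mathfrak P}$ to finite linear combinations gives the underlying left $\mathfrak R$-module. For an open right ideal $\mathfrak I\subset\mathfrak R$, $\mathfrak I\rightthreetimes\mathfrak P\subset\mathfrak P$ is the image under $\pi_{\mathfrak P}$ of the set of those elements of $\mathfrak R[[\mathfrak P]]$ whose coefficients all lie in $\mathfrak I$. The contramodule $\mathfrak P$ is separated if $\bigcap_{\mathfrak I}(\mathfrak I\rightthreetimes\mathfrak P)=0$ (over all open right ideals). $\mathfrak R\text{-}\mathsf{Separ}\subset\mathfrak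 R\text{-}\mathsf{Contra}$ is the full subcategory of separated left contramodules. A continuous ring homomorphism $\mathfrak f\colon\mathfrak R\to\mathfrak S$ induces maps $\mathfrak R[[X]]\to\mathfrak S[[X]]$; precomposing $\pi_{\mathfrak Q}\colon\mathfrak S[[\mathfrak Q]]\to\mathfrak Q$ with $\mathfrak R[[\mathfrak Q]]\to\mathfrak S[[\mathfrak Q]]$ defines the restriction of scalars $\mathfrak f_\sharp\colon\mathfrak S\text{-}\mathsf{Contra}\to\mathfrak R\text{-}\mathsf{Contra}$, which takes separated contramodules to separated contramodules. *)

(* Defs.v *)
From HB Require Import structures.
From mathcomp Require Import all_boot all_order all_algebra.
From mathcomp Require Import finmap generic_quotient ring_quotient.
From mathcomp Require Import all_classical topology tvs.
From mathcomp Require summability.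

Set Implicit Arguments.
Unset Strict Implicit.
Unset Printing Implicit Defensive.

Import GRing.Theory.
Local Open Scope classical_set_scope.
Local Open Scope ring_scope.
Local Open Scope quotient_scope.

Definition subgroup (V : zmodType) (U : set V) : Prop :=
  U 0 /\ forall x y, U x -> U y -> U (x - y).

Definition right_ideal (R : pzRingType) (I : set R) : Prop :=
  subgroup I /\ forall x a, I x -> I (x * a).

Definition two_sided_ideal (R : pzRingType) (I : set R) : Prop :=
  right_ideal I /\ forall a x, I x -> I (a * x).

Definition right_ideal_gen (R : pzRingType) (A : set R) : set R :=
  smallest (@right_ideal R) A.

Definition coset (V : zmodType) (U : set V) (x : V) : set V :=
  [set y | U (y - x)].

Record ideal2 (R : pzRingType) := Ideal2 {
  ideal2_set :> set R;
  ideal2P : two_sided_ideal ideal2_set }.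

Section QuotientRing.
Variables (R : pzRingType) (I : ideal2 R).

Definition ideal2_mem : R -> bool := fun x => `[< ideal2_set I x >].

Lemma ideal2_zmod_closed : zmod_closed ideal2_mem.
Proof.
have [[[I0 IB] _] _] := ideal2P I.
split; first exact/asboolP.
by move=> x y /asboolP Ix /asboolP Iy; apply/asboolP; exact: IB.
Qed.

HB.instance Definition _ := GRing.isZmodClosed.Build R ideal2_mem
  ideal2_zmod_closed.

(* The library's ring structure on [{quot _}] is restricted to proper ideals
   of commutative rings, hence the reconstruction on top of its additive
   quotient. *)
Definition quotring := Quotient.quot (GRing.ZmodClosed.clone R ideal2_mem _).

HB.instance Definition _ := GRing.Zmodule.on quotring.
HB.instance Definition _ :=
  EqQuotient.on quotring.
HB.instance Definition _ :=
  ZmodQuotient.on quotring.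

Definition quotring_pi (x : R) : quotring := \pi_quotring x.
Definition quotring_one : quotring := quotring_pi 1.
Definition quotring_mul (p q : quotring) : quotring :=
  quotring_pi (repr p * repr q).

Lemma quotring_piP x y : reflect (quotring_pi x = quotring_pi y) `[< ideal2_set I (x - y) >].
Proof.
have -> : `[< ideal2_set I (x - y) >] = (quotring_pi x == quotring_pi y).
  by rewrite /quotring_pi -Quotient.idealrBE.
exact: eqP.
Qed.

Lemma quotring_reprK p : quotring_pi (repr p) = p.
Proof. exact: reprK. Qed.

Lemma quotring_piM x y :
  quotring_pi (x * y) = quotring_mul (quotring_pi x) (quotring_pi y).
Proof.
have [[[I0 IB] IMr] IMl] := ideal2P I.
pose IS := ideal2_set I.
have ID a b : IS a -> IS b -> IS (a + b).
  by move=> Ia Ib; rewrite -[b]opprK; apply: (IB) => //; rewrite -sub0r; exact: (IB).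
apply/quotring_piP/asboolP.
set x' := repr _; set y' := repr _.
have Ix : IS (x - x').
  by apply/asboolP/quotring_piP; rewrite quotring_reprK.
have Iy : IS (y - y').
  by apply/asboolP/quotring_piP; rewrite quotring_reprK.
have -> : x * y - x' * y' = (x - x') * y + x' * (y - y').
  by rewrite mulrBl mulrBr addrA subrK.
by apply: ID; [exact: IMr|exact: IMl].
Qed.

Lemma quotring_piD x y : quotring_pi (x + y) = quotring_pi x + quotring_pi y.
Proof. by rewrite /quotring_pi !piE. Qed.

Lemma quotring_piB x y : quotring_pi (x - y) = quotring_pi x - quotring_pi y.
Proof. by rewrite /quotring_pi !piE. Qed.

Lemma quotring_mulA : associative quotring_mul.
Proof.
move=> p q r; rewrite -[p]quotring_reprK -[q]quotring_reprK -[r]quotring_reprK.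
by rewrite -!quotring_piM mulrA.
Qed.

Lemma quotring_mul1l : left_id quotring_one quotring_mul.
Proof.
by move=> p; rewrite -[p]quotring_reprK -quotring_piM mul1r.
Qed.

Lemma quotring_mul1r : right_id quotring_one quotring_mul.
Proof.
by move=> p; rewrite -[p]quotring_reprK -quotring_piM mulr1.
Qed.

Lemma quotring_mulDl : left_distributive quotring_mul +%R.
Proof.
move=> p q r; rewrite -[p]quotring_reprK -[q]quotring_reprK -[r]quotring_reprK.
by rewrite -quotring_piD -!quotring_piM -quotring_piD mulrDl.
Qed.

Lemma quotring_mulDr : right_distributive quotring_mul +%R.
Proof.
move=> p q r; rewrite -[p]quotring_reprK -[q]quotring_reprK -[r]quotring_reprK.
by rewrite -quotring_piD -!quotring_piM -quotring_piD mulrDr.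
Qed.

HB.instance Definition _ := GRing.Zmodule_isPzRing.Build quotring
  quotring_mulA quotring_mul1l quotring_mul1r quotring_mulDl quotring_mulDr.

Lemma quotring_pi_zmod_morphism : zmod_morphism quotring_pi.
Proof. exact: quotring_piB. Qed.

Lemma quotring_pi_monoid_morphism : monoid_morphism quotring_pi.
Proof. by split=> // x y; exact: quotring_piM. Qed.

HB.instance Definition _ := GRing.isZmodMorphism.Build R quotring quotring_pi
  quotring_pi_zmod_morphism.
HB.instance Definition _ := GRing.isMonoidMorphism.Build R quotring quotring_pi
  quotring_pi_monoid_morphism.

End QuotientRing.

Section QuotientMap.
Variables (R S : pzRingType) (f : {rmorphism R -> S}).
Variables (I : ideal2 R) (J : ideal2 S) (fIJ : f @` I `<=` J).

Definition quotmap (p : quotring I) : quotring J := quotring_pi J (f (repr p)).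

Lemma quotmap_pi x : quotmap (quotring_pi I x) = quotring_pi J (f x).
Proof.
apply/quotring_piP/asboolP; rewrite -rmorphB; apply: fIJ.
exists (repr (quotring_pi I x) - x) => //.
by apply/asboolP/quotring_piP; rewrite quotring_reprK.
Qed.

Lemma quotmap_zmod_morphism : zmod_morphism quotmap.
Proof.
move=> p q; rewrite -[p]quotring_reprK -[q]quotring_reprK.
by rewrite -rmorphB !quotmap_pi !rmorphB.
Qed.

Lemma quotmap_monoid_morphism : monoid_morphism quotmap.
Proof.
split=> [|p q].
  by rewrite -(rmorph1 (quotring_pi I)) quotmap_pi !rmorph1.
rewrite -[p]quotring_reprK -[q]quotring_reprK.
by rewrite -rmorphM !quotmap_pi !rmorphM.
Qed.

HB.instance Definition _ := GRing.isZmodMorphism.Build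
  (quotring I) (quotring J) quotmap quotmap_zmod_morphism.
HB.instance Definition _ := GRing.isMonoidMorphism.Build
  (quotring I) (quotring J) quotmap quotmap_monoid_morphism.

Definition induced_map : {rmorphism quotring I -> quotring J} := quotmap.

End QuotientMap.

(* Rings are [pzRingType]s: the zero ring is allowed. *)
Definition ring_epi (A B : pzRingType) (g : {rmorphism A -> B}) : Prop :=
  forall (T : pzRingType) (h k : {rmorphism B -> T}),
    h \o g =1 k \o g -> h =1 k.

HB.mixin Record isTopologicalRing R & TopologicalZmodule R & GRing.PzRing R := {
  mul_continuous : continuous (fun x : R * R => x.1 * x.2) }.

#[short(type="topRingType")]
HB.structure Definition TopologicalRing :=
  {R of TopologicalZmodule R & GRing.PzRing R & isTopologicalRing R}.

Definition open_subgroup (R : topologicalZmodType) (U : set R) : Prop :=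
  open U /\ subgroup U.

Definition nbhs0_base (R : topologicalZmodType) (B : set (set R)) : Prop :=
  filter_from B id = nbhs (0 : R).

Definition countable_nbhs0_base (R : topologicalZmodType) : Prop :=
  exists2 B : set (set R), countable B & nbhs0_base B.

Definition two_sided_linear (R : topRingType) : Prop :=
  nbhs0_base [set I : set R | open I /\ two_sided_ideal I].

(* An element of the projective limit of the quotients R / U is a family of
   cosets C U of the open subgroups U, compatible with the projections
   R / U -> R / V for U contained in V. *)
Definition in_proj_lim (R : topologicalZmodType) (C : set R -> set R) : Prop :=
  (forall U, open_subgroup U -> exists x, C U = coset U x) /\
  (forall U V, open_subgroup U -> open_subgroup V ->
     U `<=` V -> C U `<=` C V).

(* Bijectivity of the natural map x |-> (x + U)_U. *)
Definition complete_separated (R : topologicalZmodType) : Prop :=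
  forall C : set R -> set R, in_proj_lim C ->
    exists! x : R, forall U, open_subgroup U -> C U = coset U x.

HB.mixin Record isCompleteLinear R & TopologicalRing R := {
  two_sided_linearP : two_sided_linear R ;
  complete_separatedP : complete_separated R }.

#[short(type="completeLinearRingType")]
HB.structure Definition CompleteLinearRing :=
  {R of TopologicalRing R & isCompleteLinear R}.

Definition strongly_right_taut (R S : topRingType) (f : R -> S) : Prop :=
  nbhs0_base [set I : set R | [/\ open I, two_sided_ideal I,
    open (closure (right_ideal_gen (f @` I))) &
    two_sided_ideal (closure (right_ideal_gen (f @` I)))]].

(* The continuity of f is a separate hypothesis. *)
Definition proepimorphism (R S : topRingType) (f : {rmorphism R -> S}) : Prop :=
  forall (I : ideal2 R) (J : ideal2 S), open (I : set R) -> open (J : set S) ->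
  forall fIJ : f @` I `<=` J, ring_epi (induced_map fIJ).

Definition cvg0_family (R : topologicalZmodType) (X : Type) (r : X -> R) : Prop :=
  forall U : set R, open_subgroup U -> finite_set [set x | ~ U (r x)].

(* The limit of the net of finite partial sums (0 if there is none). *)
Definition infsum (R : topologicalZmodType) (X : choiceType) (r : X -> R) : R :=
  xget 0 [set l : R | summability.partial_sum r @ summability.totally --> l].

Notation zero_outside D r := (patch (fun=> 0) D r).

Section SumTheory.
Variable R : completeLinearRingType.
Implicit Types (X Y : choiceType) (U V : set R).

Lemma open_subgroup0 U : open_subgroup U -> U 0.
Proof. by case=> _ []. Qed.

Lemma open_subgroupB U x y : open_subgroup U -> U x -> U y -> U (x - y).
Proof. by case=> _ [_]; apply. Qed.

Lemma open_subgroupN U x : open_subgroup U -> U x -> U (- x).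
Proof.
by move=> oU Ux; rewrite -sub0r; apply: open_subgroupB => //; exact: open_subgroup0.
Qed.

Lemma open_subgroupD U x y : open_subgroup U -> U x -> U y -> U (x + y).
Proof.
by move=> oU Ux Uy; rewrite -[y]opprK; apply: open_subgroupB => //; exact: open_subgroupN.
Qed.

Lemma open_subgroup_sum U X (s : seq X) (P : pred X) (r : X -> R) :
  open_subgroup U -> (forall x, x \in s -> P x -> U (r x)) ->
  U (\sum_(x <- s | P x) r x).
Proof.
move=> oU Ur; rewrite big_seq_cond; elim/big_ind: _.
- exact: open_subgroup0.
- by move=> x y; exact: open_subgroupD.
- by move=> x /andP[]; exact: Ur.
Qed.

Lemma open_subgroup_ideal (I : set R) :
  open I -> two_sided_ideal I -> open_subgroup I.
Proof. by move=> oI [[]]. Qed.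

Lemma nbhs0_open_ideal (A : set R) : nbhs (0 : R) A ->
  exists I : set R, [/\ open I, two_sided_ideal I & I `<=` A].
Proof.
by rewrite -(@two_sided_linearP R) => -[I [oI iI] IA]; exists I.
Qed.

Lemma open_subgroup_nbhs0 U : open_subgroup U -> nbhs (0 : R) U.
Proof. by move=> oU; apply: open_nbhs_nbhs; split; [case: oU|exact: open_subgroup0]. Qed.

Lemma open_subgroup_ideal_sub U : open_subgroup U ->
  exists I : set R, [/\ open I, two_sided_ideal I & I `<=` U].
Proof. by move=> /open_subgroup_nbhs0/nbhs0_open_ideal. Qed.

Lemma coset_nbhs U x : open_subgroup U -> nbhs x (coset U x).
Proof.
move=> oU.
have : nbhs (x - x) U by rewrite subrr; exact: open_subgroup_nbhs0.
have /= h : {for x, continuous (fun y : R => y - x)}.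
  apply: (@continuous_comp _ _ _ (fun y : R => (y, x)) (fun z : R * R => z.1 - z.2)).
    by apply: cvg_pair => /=; [exact: cvg_id|exact: cvg_cst].
  exact: sub_continuous.
exact: h.
Qed.

Lemma nbhs_coset (x : R) A : nbhs x A -> exists2 U, open_subgroup U & coset U x `<=` A.
Proof.
move=> Ax.
have h : {for 0, continuous (fun y : R => y + x)}.
  apply: (@continuous_comp _ _ _ (fun y : R => (y, x)) (fun z : R * R => z.1 + z.2)).
    by apply: cvg_pair => /=; [exact: cvg_id|exact: cvg_cst].
  exact: add_continuous.
have : nbhs (0 + x) A by rewrite add0r.
move=> /h /nbhs0_open_ideal[I [oI iI IA]].
exists I; first exact: open_subgroup_ideal.
by move=> y /IA /=; rewrite subrK.
Qed.

Lemma eq_mod_open (x y : R) : (forall U, open_subgroup U -> U (x - y)) -> x = y.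
Proof.
move=> xy.
have cC : in_proj_lim (fun U => coset U y).
  split=> [U _|U V _ _ UV z]; first by exists y.
  exact: UV.
have [z [_ uz]] := @complete_separatedP R _ cC.
rewrite -(uz y) //; apply/esym/uz => U oU.
apply/seteqP; split => t; rewrite /coset /= => tz.
  have -> : t - x = (t - y) - (x - y) by rewrite opprB addrA subrK.
  by apply: open_subgroupB => //; exact: xy.
have -> : t - y = (t - x) + (x - y) by rewrite addrA subrK.
by apply: open_subgroupD => //; exact: xy.
Qed.

Lemma partial_sumE X (r : X -> R) (A : {fset X}) :
  summability.partial_sum r A = \sum_(x <- A) r x.
Proof. by rewrite /summability.partial_sum big_seq_fsetE. Qed.

Lemma sum_fset_mod U X (r : X -> R) (A B : {fset X}) : open_subgroup U ->
  (forall x, x \notin A -> U (r x)) -> (forall x, x \notin B -> U (r x)) ->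
  U (\sum_(x <- A) r x - \sum_(x <- B) r x).
Proof.
move=> oU UA UB.
have key (C D : {fset X}) : (forall x, x \notin C -> U (r x)) ->
    U (\sum_(x <- (C `|` D)%fset) r x - \sum_(x <- C) r x).
  move=> UC.
  rewrite (big_fsetID _ (fun x => x \in C)) /=.
  have -> : [fset x | x in (C `|` D)%fset & x \in C]%fset = C.
    by apply/fsetP => x; rewrite !inE /=; case: (x \in C); rewrite ?andbT ?andbF.
  rewrite addrC addrK; apply: open_subgroup_sum => // x.
  by rewrite !inE /= => /andP[_ xC] _; exact: UC.
have -> : \sum_(x <- A) r x - \sum_(x <- B) r x =
    (\sum_(x <- (B `|` A)%fset) r x - \sum_(x <- B) r x) -
    (\sum_(x <- (A `|` B)%fset) r x - \sum_(x <- A) r x).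
  by rewrite fsetUC opprB [RHS]addrC addrA subrK.
by apply: open_subgroupB => //; exact: key.
Qed.

Lemma cvg0_fset U X (r : X -> R) : cvg0_family r -> open_subgroup U ->
  exists A : {fset X}, forall x, x \notin A -> U (r x).
Proof.
move=> r0 oU; exists (fset_set [set x | ~ U (r x)]) => x.
rewrite in_fset_set; last exact: r0.
by rewrite notin_setE /= => /contrapT.
Qed.

Lemma infsum_cvg X (r : X -> R) : cvg0_family r ->
  summability.partial_sum r @ summability.totally --> infsum r.
Proof.
move=> r0; rewrite /infsum; case: xgetP => [l -> //|/= nol]; exfalso.
pose A U := fset_set [set x | ~ U (r x)].
have AP U x : open_subgroup U -> x \notin A U -> U (r x).
  move=> oU; rewrite in_fset_set; last exact: r0.
  by rewrite notin_setE /= => /contrapT.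
have cC : in_proj_lim (fun U => coset U (\sum_(x <- A U) r x)).
  split=> [U _|U V oU oV UV z]; first by eexists.
  rewrite /coset /= => /UV Vz.
  have -> : z - \sum_(x <- A V) r x =
    z - \sum_(x <- A U) r x + (\sum_(x <- A U) r x - \sum_(x <- A V) r x).
    by rewrite addrA subrK.
  apply: open_subgroupD => //; apply: sum_fset_mod => // x; last exact: AP.
  by move=> xA; apply: UV; exact: AP.
have [l [lC _]] := @complete_separatedP R _ cC.
apply: (nol l) => B /nbhs_coset[U oU UB].
exists (A U) => // D /= AD; apply: UB.
have /seteqP[h _] := lC _ oU.
apply: h; rewrite /coset /= partial_sumE; apply: sum_fset_mod => // x.
  by move=> xD; apply: AP => //; apply: contra xD; exact: (fsubsetP AD).
exact: AP.
Qed.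

Lemma infsum_mod U X (r : X -> R) (B : {fset X}) :
  cvg0_family r -> open_subgroup U -> (forall x, x \notin B -> U (r x)) ->
  U (infsum r - \sum_(x <- B) r x).
Proof.
move=> r0 oU UB.
have [A _ hA] := infsum_cvg r0 (coset_nbhs (infsum r) oU).
have {hA} := hA (A `|` B)%fset (fsubsetUl _ _).
rewrite /= /coset /= partial_sumE => hA.
rewrite -[infsum r](subrK (\sum_(x <- (A `|` B)%fset) r x)) -addrA.
apply: open_subgroupD => //; first by rewrite -opprB; exact: open_subgroupN.
apply: sum_fset_mod => // x.
by rewrite inE negb_or => /andP[_]; exact: UB.
Qed.

Lemma infsum_in U X (r : X -> R) :
  cvg0_family r -> open_subgroup U -> (forall x, U (r x)) -> U (infsum r).
Proof.
move=> r0 oU Ur; have := @infsum_mod U X r fset0 r0 oU (fun x _ => Ur x).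
by rewrite big_seq_fset0 subr0.
Qed.

Lemma cvg0_restrict X (D : set X) (r : X -> R) :
  cvg0_family r -> cvg0_family (zero_outside D r).
Proof.
move=> r0 U oU; apply: sub_finite_set (r0 U oU) => x /=.
rewrite /patch; case: ifPn => // _ /(_ (open_subgroup0 oU)) [].
Qed.

Lemma cvg0_push X Y (g : X -> Y) (r : X -> R) : cvg0_family r ->
  cvg0_family (fun y => infsum (zero_outside [set x | g x = y] r)).
Proof.
move=> r0 U oU; apply: sub_finite_set (finite_image g (r0 U oU)) => y /= nU.
apply: contrapT => ny; apply: nU; apply: infsum_in => //; first exact: cvg0_restrict.
move=> x; rewrite /patch; case: ifPn => [|_]; last exact: open_subgroup0.
rewrite inE /= => gxy; apply: contrapT => nUr; apply: ny.
by exists x.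
Qed.

Lemma infsum_push X Y (g : X -> Y) (r : X -> R) : cvg0_family r ->
  infsum (fun y => infsum (zero_outside [set x | g x = y] r)) = infsum r.
Proof.
move=> r0; apply: eq_mod_open => U oU.
have [A UA] := cvg0_fset r0 oU.
pose B := [fset g x | x in A]%fset.
set s := fun y => _.
have sB y : y \notin B -> U (s y).
  move=> yB; apply: infsum_in => //; first exact: cvg0_restrict.
  move=> x; rewrite /patch; case: ifPn => [|_]; last exact: open_subgroup0.
  rewrite inE /= => gxy; apply: UA; apply: contra yB => xA.
  by apply/imfsetP; exists x.
have h1 := infsum_mod (cvg0_push g r0) oU sB.
have h2 := infsum_mod r0 oU UA.
have h3 : U (\sum_(y <- B) s y - \sum_(y <- B) \sum_(x <- A) (zero_outside [set x | g x = y] r) x).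
  rewrite -sumrB; apply: open_subgroup_sum => // y _ _.
  apply: infsum_mod => //; first exact: cvg0_restrict.
  move=> x xA; rewrite /patch; case: ifP => _; first exact: UA.
  exact: open_subgroup0.
have e : \sum_(y <- B) \sum_(x <- A) (zero_outside [set x | g x = y] r) x = \sum_(x <- A) r x.
  rewrite exchange_big /=; apply: eq_big_seq => x xA.
  have gxB : g x \in B by apply/imfsetP; exists x.
  rewrite (big_fsetD1 (g x)) //= {1}/patch mem_set //= big_seq big1 ?addr0 // => y.
  rewrite !inE => /andP[ygx _]; rewrite /patch memNset //= => gxy.
  by rewrite gxy eqxx in ygx.
rewrite e in h3.
rewrite -[infsum s](subrK (\sum_(y <- B) s y)) -addrA.
apply: open_subgroupD => //.
rewrite -[X in U (X - _)](subrK (\sum_(x <- A) r x)) -addrA.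
apply: open_subgroupD => //; rewrite -opprB; exact: open_subgroupN.
Qed.

Lemma cvg0_mul X (r a : X -> R) : cvg0_family r -> cvg0_family (fun x => r x * a x).
Proof.
move=> r0 U /open_subgroup_ideal_sub[I [oI iI IU]].
apply: sub_finite_set (r0 I (open_subgroup_ideal oI iI)) => x /= nU Ir.
by apply: nU; apply: IU; apply: iI.1.2.
Qed.

Lemma infsum_mulr X (r : X -> R) a : cvg0_family r ->
  infsum (fun x => r x * a) = infsum r * a.
Proof.
move=> r0; apply: eq_mod_open => U /open_subgroup_ideal_sub[I [oI iI IU]].
have oI' := open_subgroup_ideal oI iI.
apply: IU; have [A IA] := cvg0_fset r0 oI'.
have h1 := infsum_mod r0 oI' IA.
have h2 : I (infsum (fun x => r x * a) - \sum_(x <- A) r x * a).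
  apply: infsum_mod => //; first exact: cvg0_mul.
  by move=> x xA; apply: iI.1.2; exact: IA.
rewrite -big_distrl /= in h2.
have -> : infsum (fun x => r x * a) - infsum r * a =
    (infsum (fun x => r x * a) - (\sum_(x <- A) r x) * a) -
    (infsum r - \sum_(x <- A) r x) * a.
  by rewrite mulrBl opprB addrA subrK.
by apply: open_subgroupB => //; apply: iI.1.2.
Qed.

Lemma cvg0_bind (X Y : choiceType) (s : Y -> R) (m : Y -> X -> R) :
  cvg0_family s -> (forall y, cvg0_family (m y)) ->
  cvg0_family (fun x => infsum (fun y => s y * m y x)).
Proof.
move=> s0 m0 U /open_subgroup_ideal_sub[I [oI iI IU]].
have oI' := open_subgroup_ideal oI iI.
have fin : finite_set (\bigcup_(y in [set y | ~ I (s y)]) [set x | ~ I (m y x)]).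
  by apply: bigcup_finite => [|y _]; [exact: s0|exact: m0].
apply: sub_finite_set fin => x /= nU; apply: contrapT => nx; apply: nU.
apply: IU; apply: infsum_in => //; first exact: cvg0_mul.
move=> y; have [Is|nIs] := pselect (I (s y)); first exact: iI.1.2.
by apply: iI.2; apply: contrapT => nIm; apply: nx; exists y.
Qed.

End SumTheory.

Section SumMap.
Variables (R S : completeLinearRingType) (f : {rmorphism R -> S}).
Hypothesis cf : continuous f.

Lemma preimage_open_subgroup (U : set S) :
  open_subgroup U -> open_subgroup (f @^-1` U).
Proof.
move=> oU; split; first by apply: open_comp; [move=> x _; exact: cf|case: oU].
split=> [|x y Ux Uy]; first by rewrite /preimage /= rmorph0; exact: open_subgroup0.
by rewrite /preimage /= rmorphB; exact: open_subgroupB.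
Qed.

Lemma cvg0_map (X : choiceType) (r : X -> R) : cvg0_family r -> cvg0_family (f \o r).
Proof. by move=> r0 U /preimage_open_subgroup/r0. Qed.

Lemma infsum_map (X : choiceType) (r : X -> R) : cvg0_family r ->
  infsum (f \o r) = f (infsum r).
Proof.
move=> r0; apply: eq_mod_open => U oU.
have oV := preimage_open_subgroup oU.
have [A VA] := cvg0_fset r0 oV.
have /= h1 := infsum_mod r0 oV VA.
rewrite rmorphB rmorph_sum in h1.
have h2 := @infsum_mod S U X (f \o r) A (cvg0_map r0) oU VA.
rewrite -[infsum (f \o r)](subrK (\sum_(x <- A) f (r x))) -addrA.
apply: open_subgroupD => //; rewrite -opprB; exact: open_subgroupN.
Qed.

End SumMap.

Record lincomb (R : topologicalZmodType) (X : Type) := Lincomb {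
  coef : X -> R;
  coef_cvg0 : cvg0_family coef }.

HB.instance Definition _ R X := gen_eqMixin (@lincomb R X).
HB.instance Definition _ R X := gen_choiceMixin (@lincomb R X).

Lemma lincombP (R : topologicalZmodType) X (r s : lincomb R X) :
  coef r =1 coef s -> r = s.
Proof.
case: r s => [r r0] [s s0] /= /funext rs; case: s / rs s0 => s0.
by congr Lincomb; exact: Prop_irrelevance.
Qed.

Section Monad.
Variable R : completeLinearRingType.
Implicit Types X Y : choiceType.

Lemma cvg0_zero X : cvg0_family (fun _ : X => 0 : R).
Proof.
move=> U oU; rewrite (_ : [set _ | _] = set0) ?finite_set0 //.
by apply/seteqP; split=> x //= []; exact: open_subgroup0.
Qed.

Lemma cvg0_unit X (x : X) : cvg0_family (fun y => (y == x)%:R : R).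
Proof.
move=> U oU; apply: sub_finite_set (finite_set1 x) => y /=.
by case: eqP => //= _ []; exact: open_subgroup0.
Qed.

Definition lc_zero X : lincomb R X :=
  @Lincomb R X (fun _ => 0) (@cvg0_zero X).

Definition lc_unit X (x : X) : lincomb R X :=
  @Lincomb R X (fun y => (y == x)%:R) (cvg0_unit x).

Definition lc_map X Y (g : X -> Y) (r : lincomb R X) : lincomb R Y :=
  @Lincomb R Y (fun y => infsum (zero_outside [set x | g x = y] (coef r)))
    (cvg0_push g (coef_cvg0 r)).

(* sum_r s_r (sum_x r_x x) |-> sum_x (sum_r s_r r_x) x *)
Definition lc_mult X (s : lincomb R (lincomb R X)) : lincomb R X :=
  @Lincomb R X (fun x => infsum (fun r : lincomb R X => coef s r * coef r x))
    (cvg0_bind (coef_cvg0 s) (fun r => coef_cvg0 r)).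

Lemma lc_map_comp (X Y Z : choiceType) (g : X -> Y) (h : Y -> Z) (r : lincomb R X) :
  lc_map (h \o g) r = lc_map h (lc_map g r).
Proof.
apply: lincombP => z /=.
rewrite -(infsum_push g); last exact/cvg0_restrict/coef_cvg0.
congr infsum; apply/funext => y; rewrite /patch.
case: ifPn; rewrite ?inE ?notin_setE /= => hyz.
  congr infsum; apply/funext => x.
  case: ifPn; rewrite ?inE ?notin_setE /= => gxy //.
  by rewrite ifT // inE /= gxy.
apply: eq_mod_open => U oU; rewrite subr0; apply: infsum_in => //.
  by apply: cvg0_restrict; apply: cvg0_restrict; exact: coef_cvg0.
move=> x; case: ifPn => [|_]; last exact: open_subgroup0.
rewrite inE /= => gxy; rewrite ifF; first exact: open_subgroup0.
by apply/negbTE; rewrite notin_setE /= gxy.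
Qed.

End Monad.

(* Index sets and carriers are [choiceType]s; by the choice axiom of [boolp]
   every type can be equipped with such a structure. *)
Record contramodule (R : completeLinearRingType) := Contramodule {
  contra_sort :> choiceType;
  contra_pi : lincomb R contra_sort -> contra_sort;
  contra_unit : forall p, contra_pi (lc_unit R p) = p;
  contra_assoc : forall s : lincomb R (lincomb R contra_sort),
    contra_pi (lc_map contra_pi s) = contra_pi (lc_mult s) }.

Definition contra0 (R : completeLinearRingType) (P : contramodule R) : P :=
  contra_pi (lc_zero R P).

Record contra_hom (R : completeLinearRingType) (P Q : contramodule R) := ContraHom {
  contra_fun :> P -> Q;
  contra_funP : forall r : lincomb R P,
    contra_fun (contra_pi r) = contra_pi (lc_map contra_fun r) }.

Definition contra_act (R : completeLinearRingType) (I : set R)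
    (P : contramodule R) : set P :=
  [set contra_pi r | r in [set r : lincomb R P | forall p, I (coef r p)]].

Arguments contra_act {R} I P.

Definition separated (R : completeLinearRingType) (P : contramodule R) : Prop :=
  \bigcap_(I in [set I : set R | open I /\ right_ideal I]) contra_act I P
    = [set contra0 P].

Record separ (R : completeLinearRingType) := Separ {
  separ_contra :> contramodule R;
  separP : separated separ_contra }.

Section Restriction.
Variables (R S : completeLinearRingType) (f : {rmorphism R -> S}).
Hypothesis cf : continuous f.

Definition lc_scalar (X : choiceType) (r : lincomb R X) : lincomb S X :=
  @Lincomb S X (f \o coef r) (cvg0_map cf (coef_cvg0 r)).

Lemma lc_scalar_zero X : lc_scalar (lc_zero R X) = lc_zero S X.
Proof. by apply: lincombP => x /=; rewrite rmorph0. Qed.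

Lemma lc_scalar_unit (X : choiceType) (x : X) :
  lc_scalar (lc_unit R x) = lc_unit S x.
Proof. by apply: lincombP => y /=; rewrite rmorph_nat. Qed.

Lemma lc_scalar_map (X Y : choiceType) (g : X -> Y) (r : lincomb R X) :
  lc_scalar (lc_map g r) = lc_map g (lc_scalar r).
Proof.
apply: lincombP => y /=; rewrite -infsum_map //; last exact/cvg0_restrict/coef_cvg0.
congr infsum; apply/funext => x; rewrite /patch /=.
by case: ifP => // _; rewrite rmorph0.
Qed.

Lemma lc_scalar_mult (X : choiceType) (s : lincomb R (lincomb R X)) :
  lc_scalar (lc_mult s) = lc_mult (lc_map (@lc_scalar X) (lc_scalar s)).
Proof.
apply: lincombP => x /=.
have s0 := coef_cvg0 s.
rewrite -infsum_map //; last exact: cvg0_mul.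
have fs0 := cvg0_map cf s0.
rewrite -(infsum_push (@lc_scalar X)); last exact/cvg0_map/cvg0_mul.
congr infsum; apply/funext => t.
rewrite -infsum_mulr; last exact: cvg0_restrict.
congr infsum; apply/funext => r; rewrite /patch /=.
case: ifPn => [|_]; last by rewrite mul0r.
by rewrite inE /= => <-; rewrite rmorphM.
Qed.

Section Object.
Variable Q : contramodule S.

Definition restrict_pi (r : lincomb R Q) : Q := contra_pi (lc_scalar r).

Lemma restrict_unit (q : Q) : restrict_pi (lc_unit R q) = q.
Proof. by rewrite /restrict_pi lc_scalar_unit contra_unit. Qed.

Lemma restrict_assoc (s : lincomb R (lincomb R Q)) :
  restrict_pi (lc_map restrict_pi s) = restrict_pi (lc_mult s).
Proof.
rewrite /restrict_pi lc_scalar_map lc_scalar_mult -contra_assoc.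
by rewrite -lc_map_comp.
Qed.

Definition restrict : contramodule R := Contramodule restrict_unit restrict_assoc.

Lemma restrict_separated : separated Q -> separated restrict.
Proof.
move=> sQ.
have e0 : contra0 restrict = contra0 Q.
  by rewrite /contra0 /= /restrict_pi lc_scalar_zero.
apply/seteqP; split => [q hq|q ->].
  suff : [set contra0 Q] q by rewrite -e0.
  rewrite -sQ => J [oJ rJ].
  have oV := preimage_open_subgroup cf (conj oJ rJ.1).
  have rV : right_ideal (f @^-1` J).
    by split=> [|x a Jx]; [case: oV|rewrite /preimage /= rmorphM; exact: rJ.2].
  have [r hr <-] := hq _ (conj oV.1 rV).
  by exists (lc_scalar r).
move=> I [oI rI]; exists (lc_zero R Q) => // p /=.
by case: rI => -[].
Qed.

End Object.

Section Morphism.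
Variables (P Q : contramodule S) (h : contra_hom P Q).

Lemma restrict_homP (r : lincomb R P) :
  h (@contra_pi R (restrict P) r) = @contra_pi R (restrict Q) (lc_map h r).
Proof. by rewrite /= /restrict_pi contra_funP lc_scalar_map. Qed.

Definition restrict_hom : contra_hom (restrict P) (restrict Q) :=
  @ContraHom R (restrict P) (restrict Q) h restrict_homP.

End Morphism.

Definition separ_restrict (Q : separ S) : separ R :=
  Separ (restrict_separated (separP Q)).

Definition separ_restrict_hom (P Q : separ S) (h : contra_hom P Q) :
  contra_hom (separ_restrict P) (separ_restrict Q) := restrict_hom h.

Definition separ_restrict_fully_faithful : Prop :=
  forall P Q : separ S, bijective (@separ_restrict_hom P Q).

End Restriction.

(* Main.v *)
Require Import Defs.
From HB Require Import structures.
From mathcomp Require Import all_boot all_order all_algebra.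
From mathcomp Require Import finmap generic_quotient ring_quotient.
From mathcomp Require Import all_classical topology tvs.

Set Implicit Arguments.
Unset Strict Implicit.
Unset Printing Implicit Defensive.

Import GRing.Theory.
Local Open Scope classical_set_scope.
Local Open Scope ring_scope.

(* (1) => (2): two ring maps h, k : S/J -> T turn T into two discrete
   S-contramodules.  If h and k agree on R/I, the identity of T is a morphism
   of R-contramodules, hence of S-contramodules, and evaluating at 1 gives
   h = k.

   (2) => (1): let I be a taut ideal and J the closure of f(I)S.  By successive
   approximation along a decreasing sequence of taut ideals, every element of
   S[[X]] with coefficients in J is the expansion of an element of R[[S[[X]]]]
   with coefficients in I; hence J P = I P for every S-contramodule P.  So a
   morphism of R-contramodules P -> Q induces an R/I-linear map of S/J-modules
   P/JP -> Q/JQ, which is S/J-linear because R/I -> S/J is an epimorphism.  As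
   formal combinations are finite modulo J, the original map commutes with the
   S-contramodule structures modulo every JQ, hence exactly if Q is
   separated. *)

(** * Endomorphism rings of abelian groups, the targets for testing epimorphisms *)

Record zmod_end (V : zmodType) := ZmodEnd {
  zmod_end_fun :> V -> V;
  zmod_end_additive : zmod_morphism zmod_end_fun }.

HB.instance Definition _ V := gen_eqMixin (zmod_end V).
HB.instance Definition _ V := gen_choiceMixin (zmod_end V).

Section EndomorphismRing.
Variable V : zmodType.
Implicit Types u v w : zmod_end V.

Lemma zmod_endP u v : u =1 v -> u = v.
Proof.
case: u v => [u uB] [v vB] /= /funext uv; case: v / uv vB => vB.
by congr ZmodEnd; exact: Prop_irrelevance.
Qed.

Lemma zmod_endD u : {morph u : x y / x + y}.
Proof.
move=> x y; have uB := @zmod_end_additive V u.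
have u0 : u 0 = 0 by have := uB 0 0; rewrite !subrr.
by rewrite -[in LHS](opprK y) uB -[- y]sub0r uB u0 sub0r opprK.
Qed.

Lemma zmod_end_zero_additive : zmod_morphism (fun _ : V => 0 : V).
Proof. by move=> x y; rewrite subr0. Qed.

Lemma zmod_end_opp_additive u : zmod_morphism (fun x => - u x).
Proof. by move=> x y; rewrite zmod_end_additive opprB opprK addrC. Qed.

Lemma zmod_end_add_additive u v : zmod_morphism (fun x => u x + v x).
Proof. by move=> x y; rewrite !zmod_end_additive opprD addrACA. Qed.

Lemma zmod_end_id_additive : zmod_morphism (@id V).
Proof. by []. Qed.

Lemma zmod_end_comp_additive u v : zmod_morphism (u \o v).
Proof. by move=> x y; rewrite /= !zmod_end_additive. Qed.

Definition zmod_end_add u v := ZmodEnd (zmod_end_add_additive u v).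
Definition zmod_end_comp u v := ZmodEnd (zmod_end_comp_additive u v).

Lemma zmod_end_addA : associative zmod_end_add.
Proof. by move=> u v w; apply: zmod_endP => x /=; rewrite addrA. Qed.

Lemma zmod_end_addC : commutative zmod_end_add.
Proof. by move=> u v; apply: zmod_endP => x /=; rewrite addrC. Qed.

Lemma zmod_end_add0r : left_id (ZmodEnd zmod_end_zero_additive) zmod_end_add.
Proof. by move=> u; apply: zmod_endP => x /=; rewrite add0r. Qed.

Lemma zmod_end_addNr : left_inverse (ZmodEnd zmod_end_zero_additive)
  (fun u => ZmodEnd (zmod_end_opp_additive u)) zmod_end_add.
Proof. by move=> u; apply: zmod_endP => x /=; rewrite addNr. Qed.

HB.instance Definition _ := GRing.isZmodule.Build (zmod_end V)
  zmod_end_addA zmod_end_addC zmod_end_add0r zmod_end_addNr.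

Lemma zmod_end_compA : associative zmod_end_comp.
Proof. by move=> u v w; exact: zmod_endP. Qed.

Lemma zmod_end_comp1r : left_id (ZmodEnd zmod_end_id_additive) zmod_end_comp.
Proof. by move=> u; exact: zmod_endP. Qed.

Lemma zmod_end_compr1 : right_id (ZmodEnd zmod_end_id_additive) zmod_end_comp.
Proof. by move=> u; exact: zmod_endP. Qed.

Lemma zmod_end_compDl : left_distributive zmod_end_comp +%R.
Proof. by move=> u v w; exact: zmod_endP. Qed.

Lemma zmod_end_compDr : right_distributive zmod_end_comp +%R.
Proof.
by move=> u v w; apply: zmod_endP => x; rewrite /= zmod_endD.
Qed.

HB.instance Definition _ := GRing.Zmodule_isPzRing.Build (zmod_end V)
  zmod_end_compA zmod_end_comp1r zmod_end_compr1
  zmod_end_compDl zmod_end_compDr.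

End EndomorphismRing.

(** * Linearity along a ring epimorphism *)

(* The two ring maps B -> End(M * N) are the diagonal action and its conjugate
   by the unipotent automorphism (m, n) |-> (m, n + g m); they agree at b
   exactly when g commutes with b. *)
Section EpimorphismLinear.
Variables (B : pzRingType) (M N : lmodType B) (g : M -> N).
Hypothesis gB : zmod_morphism g.

Lemma diag_act_additive (b : B) :
  zmod_morphism (fun x : M * N => (b *: x.1, b *: x.2) : M * N).
Proof. by move=> x y; rewrite !scalerBr. Qed.

Definition diag_act (b : B) : zmod_end (M * N)%type :=
  ZmodEnd (diag_act_additive b).

Lemma diag_act_zmod_morphism : zmod_morphism diag_act.
Proof. by move=> a b; apply: zmod_endP => -[m n]; rewrite /= !scalerBl. Qed.

Lemma diag_act_monoid_morphism : monoid_morphism diag_act.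
Proof.
split=> [|a b]; apply: zmod_endP => -[m n]; rewrite /= ?scale1r //.
by rewrite !scalerA.
Qed.

HB.instance Definition _ := GRing.isZmodMorphism.Build B
  (zmod_end (M * N)%type) diag_act diag_act_zmod_morphism.
HB.instance Definition _ := GRing.isMonoidMorphism.Build B
  (zmod_end (M * N)%type) diag_act diag_act_monoid_morphism.

Lemma shear_additive :
  zmod_morphism (fun x : M * N => (x.1, x.2 + g x.1) : M * N).
Proof.
by move=> x y; apply: injective_projections; rewrite //= gB opprD addrACA.
Qed.

Lemma unshear_additive :
  zmod_morphism (fun x : M * N => (x.1, x.2 - g x.1) : M * N).
Proof.
by move=> x y; apply: injective_projections; rewrite //= gB !opprD addrACA.
Qed.

Let u : zmod_end (M * N)%type := ZmodEnd shear_additive.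
Let v : zmod_end (M * N)%type := ZmodEnd unshear_additive.

Definition shear_act (b : B) : zmod_end (M * N)%type := u * diag_act b * v.

Lemma shear_act_zmod_morphism : zmod_morphism shear_act.
Proof. by move=> a b; rewrite /shear_act rmorphB mulrBr mulrBl. Qed.

Lemma shear_act_monoid_morphism : monoid_morphism shear_act.
Proof.
have uv : u * v = 1 by apply: zmod_endP => -[m n]; rewrite /= subrK.
have vu : v * u = 1 by apply: zmod_endP => -[m n]; rewrite /= addrK.
split=> [|a b]; first by rewrite /shear_act rmorph1 mulr1.
rewrite /shear_act rmorphM !mulrA; congr (_ * _ * _).
by rewrite -[in RHS]mulrA vu mulr1.
Qed.

HB.instance Definition _ := GRing.isZmodMorphism.Build B
  (zmod_end (M * N)%type) shear_act shear_act_zmod_morphism.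
HB.instance Definition _ := GRing.isMonoidMorphism.Build B
  (zmod_end (M * N)%type) shear_act shear_act_monoid_morphism.

Lemma ring_epi_linear (A : pzRingType) (e : {rmorphism A -> B}) :
  ring_epi e -> (forall a m, g (e a *: m) = e a *: g m) ->
  forall b m, g (b *: m) = b *: g m.
Proof.
move=> epi gA b m.
(* At [(m, 0)] the second component of the conjugate action measures how far [g] is from commuting
   with [a], whereas that of the diagonal action is 0. *)
have act0 a : (shear_act a (m, 0)).2 = g (a *: m) - a *: g m.
  by rewrite /= sub0r scalerN addrC.
have eqe : diag_act \o e =1 shear_act \o e.
  move=> a; apply: zmod_endP => -[x y].
  by rewrite /= gA scalerBr subrK.
have := congr1 (fun w : zmod_end (M * N)%type => (w (m, 0)).2)
  (epi _ diag_act shear_act eqe b).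
by rewrite act0 /= scaler0 => /esym/subr0_eq.
Qed.

End EpimorphismLinear.

(** * Formal combinations as a module *)

Section LincombModule.
Variables (R : completeLinearRingType) (X : choiceType).
Implicit Types r s : lincomb R X.

Lemma lc_add_cvg0 r s : cvg0_family (fun x => coef r x + coef s x).
Proof.
move=> U oU.
have fin : finite_set ([set x | ~ U (coef r x)] `|` [set x | ~ U (coef s x)]).
  by rewrite finite_setU; split; exact: coef_cvg0.
apply: sub_finite_set fin => x /= nU; apply: contrapT => nx; apply: nU.
by apply: open_subgroupD => //; apply: contrapT => h; apply: nx; [left|right].
Qed.

Lemma lc_opp_cvg0 r : cvg0_family (fun x => - coef r x).
Proof.
move=> U oU; apply: sub_finite_set (coef_cvg0 r oU) => x /= nU Ur.
by apply: nU; exact: open_subgroupN.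
Qed.

Lemma lc_scale_cvg0 (a : R) r : cvg0_family (fun x => a * coef r x).
Proof.
move=> U /open_subgroup_ideal_sub[I [oI iI IU]].
apply: sub_finite_set (coef_cvg0 r (open_subgroup_ideal oI iI)) => x /= nU Ir.
by apply: nU; apply: IU; exact: iI.2.
Qed.

Definition lc_add r s := Lincomb (lc_add_cvg0 r s).
Definition lc_opp r := Lincomb (lc_opp_cvg0 r).
Definition lc_scale a r := Lincomb (lc_scale_cvg0 a r).

Lemma lc_addA : associative lc_add.
Proof. by move=> r s t; apply: lincombP => x /=; rewrite addrA. Qed.

Lemma lc_addC : commutative lc_add.
Proof. by move=> r s; apply: lincombP => x /=; rewrite addrC. Qed.

Lemma lc_add0r : left_id (lc_zero R X) lc_add.
Proof. by move=> r; apply: lincombP => x /=; rewrite add0r. Qed.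

Lemma lc_addNr : left_inverse (lc_zero R X) lc_opp lc_add.
Proof. by move=> r; apply: lincombP => x /=; rewrite addNr. Qed.

HB.instance Definition _ := GRing.isZmodule.Build (lincomb R X)
  lc_addA lc_addC lc_add0r lc_addNr.

Lemma lc_scalerA a b r : lc_scale a (lc_scale b r) = lc_scale (a * b) r.
Proof. by apply: lincombP => x /=; rewrite mulrA. Qed.

Lemma lc_scale1r : left_id 1 lc_scale.
Proof. by move=> r; apply: lincombP => x /=; rewrite mul1r. Qed.

Lemma lc_scalerDr : right_distributive lc_scale +%R.
Proof. by move=> a r s; apply: lincombP => x /=; rewrite mulrDr. Qed.

Lemma lc_scalerDl r : {morph lc_scale^~ r : a b / a + b}.
Proof. by move=> a b; apply: lincombP => x /=; rewrite mulrDl. Qed.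

HB.instance Definition _ := GRing.Zmodule_isLmodule.Build R (lincomb R X)
  lc_scalerA lc_scale1r lc_scalerDr lc_scalerDl.

Lemma lc_coefD r s x : coef (r + s) x = coef r x + coef s x. Proof. by []. Qed.

Lemma lc_coefB r s x : coef (r - s) x = coef r x - coef s x. Proof. by []. Qed.

Lemma lc_coef_sum (I : Type) (s : seq I) (F : I -> lincomb R X) x :
  coef (\sum_(i <- s) F i) x = \sum_(i <- s) coef (F i) x.
Proof.
by elim: s => [|i s IHs]; rewrite ?big_nil // !big_cons lc_coefD IHs.
Qed.

(** By conversion, [contra_act U P] is the image of this set under [contra_pi]. *)
Definition lc_in (U : set R) : set (lincomb R X) :=
  [set r | forall x, U (coef r x)].

Lemma lc_in_subgroup U : subgroup U -> subgroup (lc_in U).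
Proof. by case=> U0 UB; split=> [x|r s Ur Us x]; [exact: U0|exact: UB]. Qed.

Lemma lc_inZ U a r : two_sided_ideal U -> lc_in U r -> lc_in U (a *: r).
Proof. by move=> [_ UM] Ur x; exact: UM. Qed.

Lemma lc_inZl U a r : right_ideal U -> U a -> lc_in U (a *: r).
Proof. by move=> [_ UM] Ua x; exact: UM. Qed.

End LincombModule.

Lemma subgroupD (V : zmodType) (U : set V) x y :
  subgroup U -> U x -> U y -> U (x + y).
Proof.
move=> [U0 UB] Ux Uy; rewrite -[y]opprK; apply: (UB) => //.
by rewrite -sub0r; exact: (UB).
Qed.

Lemma subgroup_sum (V : zmodType) (U : set V) (I : Type) (s : seq I)
    (F : I -> V) :
  subgroup U -> (forall i, U (F i)) -> U (\sum_(i <- s) F i).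
Proof.
by move=> sU UF; elim/big_ind: _ => // [|x y]; [case: sU|exact: subgroupD].
Qed.

(** * Additivity of the monad operations *)

Section LincombLinear.
Variable R : completeLinearRingType.
Implicit Types X Y : choiceType.

(** Modulo an open subgroup, all three infinite sums reduce to sums over one common finite set. *)
Lemma infsumB X (r s : lincomb R X) :
  infsum (coef (r - s)) = infsum (coef r) - infsum (coef s).
Proof.
apply: eq_mod_open => U oU.
have [A UA] := cvg0_fset (coef_cvg0 r) oU.
have [B UB] := cvg0_fset (coef_cvg0 s) oU.
pose C := (A `|` B)%fset.
have UC x : x \notin C -> U (coef r x) /\ U (coef s x).
  by rewrite inE negb_or => /andP[/UA ? /UB].
have hr := infsum_mod (coef_cvg0 r) oU (fun x xC => (UC x xC).1).
have hs := infsum_mod (coef_cvg0 s) oU (fun x xC => (UC x xC).2).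
have hB := infsum_mod (coef_cvg0 (r - s)) oU
  (fun x xC => open_subgroupB oU (UC x xC).1 (UC x xC).2).
rewrite sumrB in hB.
have := open_subgroupB oU hB (open_subgroupB oU hr hs).
set a := infsum _; set b := \sum_(x <- C) coef r x; set c := \sum_(x <- C) _.
set d := infsum _; set e := infsum _.
have -> : d - b - (e - c) = d - e - (b - c) by rewrite !opprD addrACA.
by rewrite (opprB (d - e)) addrA subrK.
Qed.

Lemma infsum_single X (r : X -> R) (x0 : X) : cvg0_family r ->
  (forall x, x != x0 -> r x = 0) -> infsum r = r x0.
Proof.
move=> r0 rx; apply: eq_mod_open => U oU.
have := @infsum_mod R U X r [fset x0]%fset r0 oU; rewrite big_seq_fset1.
by apply=> x; rewrite inE => /rx ->; exact: open_subgroup0.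
Qed.

Lemma lc_mapB X Y (g : X -> Y) : zmod_morphism (lc_map (R := R) g).
Proof.
move=> r s; apply: lincombP => y /=.
pose D := [set x | g x = y].
rewrite -(infsumB (Lincomb (cvg0_restrict D (coef_cvg0 r)))
                  (Lincomb (cvg0_restrict D (coef_cvg0 s)))).
congr infsum; apply/funext => x /=; rewrite /patch.
by case: ifP; rewrite ?subr0.
Qed.

Lemma lc_map_scale_unit X Y (g : X -> Y) a x :
  lc_map g (a *: lc_unit R x) = a *: lc_unit R (g x).
Proof.
apply: lincombP => y /=.
rewrite (@infsum_single _ _ x).
- rewrite /patch /= eqxx mulr1.
  have [<-|gxy] := eqVneq (g x) y; first by rewrite mem_set // mulr1.
  by rewrite memNset ?mulr0 //; exact/eqP.
- exact: (cvg0_restrict _ (coef_cvg0 (a *: lc_unit R x))).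
- move=> x' /negbTE x'x; rewrite /patch /= x'x mulr0.
  by case: ifP.
Qed.

Lemma lc_map_unit X Y (g : X -> Y) x :
  lc_map g (lc_unit R x) = lc_unit R (g x).
Proof. by have := lc_map_scale_unit g 1 x; rewrite !scale1r. Qed.

Lemma lc_multB X : zmod_morphism (@lc_mult R X).
Proof.
move=> s t; apply: lincombP => x; rewrite lc_coefB /=.
rewrite -(infsumB (Lincomb (@cvg0_mul R _ _ (fun r => coef r x) (coef_cvg0 s)))
                  (Lincomb (@cvg0_mul R _ _ (fun r => coef r x) (coef_cvg0 t)))).
by congr infsum; apply/funext => r /=; rewrite mulrBl.
Qed.

Lemma lc_mult_scale_unit X a (r : lincomb R X) :
  lc_mult (a *: lc_unit R r) = a *: r.
Proof.
apply: lincombP => x /=; rewrite (@infsum_single _ _ r).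
- by rewrite /= eqxx mulr1.
- exact: (@cvg0_mul R _ _ (fun s => coef s x) (coef_cvg0 (a *: lc_unit R r))).
- by move=> r' /negbTE r'r; rewrite /= r'r mulr0 mul0r.
Qed.

Lemma lc_in_mult X U (s : lincomb R (lincomb R X)) : open_subgroup U ->
  right_ideal U -> lc_in U s -> lc_in U (lc_mult s).
Proof.
move=> oU [_ UM] Us x; apply: infsum_in => // [|r]; last exact: UM.
exact/cvg0_mul/coef_cvg0.
Qed.

Lemma lc_in_map X Y (g : X -> Y) U (s : lincomb R X) : open_subgroup U ->
  lc_in U s -> lc_in U (lc_map g s).
Proof.
move=> oU Us y; apply: infsum_in => // [|x].
  exact/cvg0_restrict/coef_cvg0.
by rewrite /patch; case: ifP => // _; exact: open_subgroup0.
Qed.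

(** Modulo [U] every formal combination is finite; this reduces additive identities to scaled units
    and combinations with coefficients in [U]. *)
Lemma lc_split X U (r : lincomb R X) : open_subgroup U ->
  exists A : {fset X},
    lc_in U (r - \sum_(x <- A) coef r x *: lc_unit R x).
Proof.
move=> oU; have [A UA] := cvg0_fset (coef_cvg0 r) oU; exists A => y.
rewrite lc_coefB lc_coef_sum.
have [yA|yA] := boolP (y \in A).
  rewrite (big_fsetD1 y) //= eqxx mulr1 big_seq big1 ?addr0 ?subrr.
    exact: open_subgroup0.
  by move=> x; rewrite !inE eq_sym => /andP[/negbTE -> _]; rewrite mulr0.
rewrite big_seq big1 ?subr0; first exact: UA.
move=> x xA /=; case: eqP => [yx|]; last by rewrite mulr0.
by rewrite yx xA in yA.
Qed.

End LincombLinear.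

HB.instance Definition _ (R : completeLinearRingType) (X Y : choiceType)
    (g : X -> Y) := GRing.isZmodMorphism.Build (lincomb R X) (lincomb R Y)
  (lc_map g) (lc_mapB g).
HB.instance Definition _ (R : completeLinearRingType) (X : choiceType) :=
  GRing.isZmodMorphism.Build (lincomb R (lincomb R X)) (lincomb R X)
    (@lc_mult R X) (@lc_multB R X).

(** * The additive structure hidden in a contramodule *)

Section ContraLinear.
Variables (R : completeLinearRingType) (P : contramodule R).
Implicit Types r s : lincomb R P.

(** [P] has no declared addition, so the difference of [p] and [q] is expressed as
    [contra_pi (lc_unit R p - lc_unit R q)]. The identity is associativity at a difference of two
    units of [R[[R[[P]]]]]. *)
Lemma contra_piB r s :
  contra_pi (r - s) =
  contra_pi (lc_unit R (contra_pi r) - lc_unit R (contra_pi s)).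
Proof.
have := contra_assoc (1 *: lc_unit R r - 1 *: lc_unit R s).
by rewrite !raddfB /= !lc_map_scale_unit !lc_mult_scale_unit !scale1r.
Qed.

Lemma contra_piZ a r :
  contra_pi (a *: r) = contra_pi (a *: lc_unit R (contra_pi r)).
Proof.
have := contra_assoc (a *: lc_unit R r).
by rewrite lc_map_scale_unit lc_mult_scale_unit.
Qed.

Lemma contra_pi_congB r r' s s' : contra_pi r = contra_pi r' ->
  contra_pi s = contra_pi s' -> contra_pi (r - s) = contra_pi (r' - s').
Proof. by move=> er es; rewrite contra_piB er es -contra_piB. Qed.

Lemma contra_pi_congZ a r r' : contra_pi r = contra_pi r' ->
  contra_pi (a *: r) = contra_pi (a *: r').
Proof. by move=> er; rewrite contra_piZ er -contra_piZ. Qed.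

(** Phrased on the preimage in [R[[P]]], where a declared group structure exists. *)
Lemma contra_act_subgroup U : subgroup U ->
  subgroup (@contra_pi R P @^-1` contra_act U P).
Proof.
move=> sU; have [L0 LB] := @lc_in_subgroup R P U sU.
split=> [|r s]; first by exists 0.
move=> [r' Lr er] [s' Ls es]; exists (r' - s'); first exact: LB.
exact: contra_pi_congB.
Qed.

Lemma contra_actZ U a r : two_sided_ideal U ->
  contra_act U P (contra_pi r) -> contra_act U P (contra_pi (a *: r)).
Proof.
move=> iU [r' Lr er]; exists (a *: r'); first exact: lc_inZ.
exact: contra_pi_congZ.
Qed.

Lemma separated_eq (p q : P) : Defs.separated P ->
  (forall U : set R, open U -> right_ideal U ->
     contra_act U P (contra_pi (lc_unit R p - lc_unit R q))) -> p = q.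
Proof.
move=> sP pq.
have : [set contra0 P] (contra_pi (lc_unit R p - lc_unit R q)).
  by rewrite -sP => U [oU rU]; exact: pq.
rewrite /= /contra0 => e0.
rewrite -[p]contra_unit -[q]contra_unit.
(* The unit at [p] becomes a difference whose first term is [lc_unit R p - lc_unit R q], which
   [contra_pi_congB] can then replace by 0. *)
rewrite -[lc_unit R p](subrK (lc_unit R q)) -[X in _ + X]opprK.
rewrite (contra_pi_congB e0 (erefl (contra_pi (- lc_unit R q)))).
by rewrite opprK add0r.
Qed.

End ContraLinear.

(** * Taut ideals and expansions with coefficients in them *)

Lemma right_ideal_gen_sub (R : pzRingType) (A : set R) :
  A `<=` right_ideal_gen A.
Proof. exact: sub_gen_smallest. Qed.

Lemma right_ideal_gen_min (R : pzRingType) (A K : set R) :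
  right_ideal K -> A `<=` K -> right_ideal_gen A `<=` K.
Proof. by move=> rK AK; exact: smallest_sub. Qed.

Lemma closed_open_subgroup (R : completeLinearRingType) (U : set R) :
  open_subgroup U -> closed U.
Proof.
move=> oU x Ux; have [y [Uy /= yx]] := Ux _ (coset_nbhs x oU).
by rewrite -[x](subKr y); exact: open_subgroupB.
Qed.

Section Taut.
Variables (R S : completeLinearRingType) (f : {rmorphism R -> S}).
Hypothesis cf : continuous f.

Definition extended_ideal (I : set R) : set S :=
  closure (right_ideal_gen (f @` I)).

Definition taut_ideal (I : set R) : Prop :=
  [/\ open I, two_sided_ideal I, open (extended_ideal I) &
      two_sided_ideal (extended_ideal I)].

Lemma image_extended_ideal I : f @` I `<=` extended_ideal I.
Proof.
by move=> y fIy; apply: subset_closure; exact: right_ideal_gen_sub.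
Qed.

Lemma extended_ideal_min I (U : set S) : open U -> right_ideal U ->
  f @` I `<=` U -> extended_ideal I `<=` U.
Proof.
move=> oU rU fIU.
have /closure_id -> := closed_open_subgroup (conj oU rU.1).
by apply: closure_subset; exact: right_ideal_gen_min.
Qed.

Lemma taut_idealP I : taut_ideal I ->
  open_subgroup I /\ open_subgroup (extended_ideal I).
Proof. by case=> oI iI oJ iJ; split; apply: open_subgroup_ideal. Qed.

(** The structure map of the free [S]-contramodule on [X], restricted along [f]. *)
Definition lc_expand (X : choiceType) (a : lincomb R (lincomb S X)) :
  lincomb S X := lc_mult (lc_scalar cf a).

Lemma lc_scalarB (X : choiceType) : zmod_morphism (@lc_scalar R S f cf X).
Proof. by move=> a b; apply: lincombP => x; rewrite /= rmorphB. Qed.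

Lemma lc_expandB (X : choiceType) : zmod_morphism (@lc_expand X).
Proof. by move=> a b; rewrite /lc_expand lc_scalarB raddfB. Qed.

HB.instance Definition _ (X : choiceType) :=
  GRing.isZmodMorphism.Build (lincomb R (lincomb S X)) (lincomb S X)
    (@lc_expand X) (@lc_expandB X).

Lemma lc_expand_scale_unit (X : choiceType) r (v : lincomb S X) :
  lc_expand (r *: lc_unit R v) = f r *: v.
Proof.
rewrite /lc_expand -[RHS]lc_mult_scale_unit; congr lc_mult.
by apply: lincombP => w /=; rewrite rmorphM rmorph_nat.
Qed.

(** Associativity in [P], in a form that lets a morphism of restricted contramodules be evaluated on
    an expansion. *)
Lemma contra_pi_expand (P : contramodule S) (a : lincomb R (lincomb S P)) :
  contra_pi (lc_expand a) =
  @contra_pi R (Defs.restrict cf P) (lc_map (@contra_pi S P) a).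
Proof. by rewrite /lc_expand -contra_assoc /= /restrict_pi lc_scalar_map. Qed.

Lemma lc_in_expand (X : choiceType) I (a : lincomb R (lincomb S X)) :
  taut_ideal I -> lc_in I a -> lc_in (extended_ideal I) (lc_expand a).
Proof.
move=> tI Ia; have [_ oJ] := taut_idealP tI; have [_ _ _ [rJ _]] := tI.
apply: lc_in_mult => // v /=; apply: image_extended_ideal.
by exists (coef a v).
Qed.

(** The approximable combinations form a group [G]. The scalars multiplying everything into [G] form
    a right ideal containing [f(I)], hence [f(I)S]; passing to the closure costs only an error with
    coefficients in [U], and so does cutting [u] down to a finite sum. *)
Lemma lc_expand_approx (X : choiceType) I (U : set S) (u : lincomb S X) :
  taut_ideal I -> open U -> right_ideal U -> lc_in (extended_ideal I) u ->
  exists2 a, lc_in I a & lc_in U (u - lc_expand a).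
Proof.
move=> tI oU rU Iu; have [oI oJ] := taut_idealP tI; have [_ [rI _] _ _] := tI.
have sLI := @lc_in_subgroup R (lincomb S X) I oI.2.
have sLU := @lc_in_subgroup S X U rU.1.
pose G := [set v : lincomb S X |
  exists2 a, lc_in I a & lc_in U (v - lc_expand a)].
have sG : subgroup G.
  split=> [|v w [a Ia Ua] [b Ib Ub]].
    by exists 0; [case: sLI|rewrite raddf0 subr0; case: sLU].
  exists (a - b); first exact: sLI.2.
  by rewrite raddfB opprD addrACA -opprD; apply: sLU.2.
have GU v : lc_in U v -> G v.
  by move=> Uv; exists 0; [case: sLI|rewrite raddf0 subr0].
(* Quantifying over all [v] gives closure under right multiplication, since
   [(s * t) *: v = s *: (t *: v)]. *)
have rK : right_ideal [set s : S | forall v, G (s *: v)].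
  split; last by move=> s t Ks v; rewrite -scalerA; exact: Ks.
  split=> [v|s t Ks Kt v]; first by rewrite scale0r; case: sG.
  by rewrite scalerBl; apply: sG.2.
have fK : f @` I `<=` [set s : S | forall v, G (s *: v)].
  move=> _ [r Ir <-] v; exists (r *: lc_unit R v).
    exact: (lc_inZl (lc_unit R v) rI Ir).
  by rewrite lc_expand_scale_unit subrr; case: sLU.
have GJ s v : extended_ideal I s -> G (s *: v).
  move=> Js; have [t [gt /= st]] := Js _ (coset_nbhs s (conj oU rU.1)).
  rewrite -[s](subKr t) scalerBl; apply: sG.2.
    exact: (right_ideal_gen_min rK fK gt).
  by apply: GU; exact: lc_inZl.
have [A UA] := lc_split u (conj oU rU.1).
suff : G u by [].
rewrite -[u](subrK (\sum_(x <- A) coef u x *: lc_unit S x)).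
apply: subgroupD => //; first exact: GU.
by apply: subgroup_sum => // x; exact: GJ.
Qed.

Hypothesis R_countable : countable_nbhs0_base R.
Hypothesis f_taut : strongly_right_taut f.

Lemma taut_ideal_sub (A : set R) : nbhs (0 : R) A ->
  exists2 I, taut_ideal I & I `<=` A.
Proof. by rewrite -f_taut => -[I tI IA]; exists I. Qed.

(** A taut ideal inside the preimage of [U] works: an open right ideal is closed, so it absorbs the
    closure. *)
Lemma taut_ideal_extended_sub (U : set S) : open U -> right_ideal U ->
  exists2 I, taut_ideal I & extended_ideal I `<=` U.
Proof.
move=> oU rU; have oV := preimage_open_subgroup cf (conj oU rU.1).
have [I tI IV] := taut_ideal_sub (open_subgroup_nbhs0 oV).
exists I => //; apply: extended_ideal_min => // _ [r Ir <-].
exact: IV.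
Qed.

(** Each term is chosen inside the previous one and inside the next member of a countable base. *)
Lemma taut_ideal_seq I : taut_ideal I ->
  exists E : nat -> set R, [/\ E 0%N = I, forall n, taut_ideal (E n),
    forall n, E n.+1 `<=` E n &
    forall A, nbhs (0 : R) A -> exists n, E n `<=` A].
Proof.
move=> tI; have [B /countable_injP[c c_inj] bB] := R_countable.
have nB b : B b -> nbhs (0 : R) b by move=> Bb; rewrite -bB; exists b.
(* The base enumerated through the injection [c]; an index that [c] misses gets the whole ring,
   which imposes no constraint. *)
pose e n := xget setT [set b | B b /\ c b = n].
have ne n : nbhs (0 : R) (e n).
  by rewrite /e; case: xgetP => [b _ [/nB]|_] //; exact: filterT.
have /choice[next nextP] (Vn : set R * nat) : exists V' : set R,
    taut_ideal Vn.1 -> taut_ideal V' /\ V' `<=` Vn.1 `&` e Vn.2.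
  have [tV|] := pselect (taut_ideal Vn.1); last by exists set0.
  have [oV _] := taut_idealP tV.
  have [V' tV' V'V] :=
    taut_ideal_sub (filterI (open_subgroup_nbhs0 oV) (ne Vn.2)).
  by exists V'.
pose E := fix E n := if n is m.+1 then next (E m, m) else I.
have tE n : taut_ideal (E n).
  by elim: n => //= n IHn; exact: (nextP (E n, n) IHn).1.
exists E; split=> // [n x /(nextP (E n, n) (tE n)).2 []|A] //.
rewrite -bB => -[b Bb bA]; exists (c b).+1.
move=> x /(nextP (E (c b), c b) (tE _)).2 [_ /= ex]; apply: bA; move: ex.
rewrite /e; case: xgetP => [b' _ [Bb' /c_inj]|/(_ b)/= []] //.
by rewrite !inE => ->.
Qed.

(* Successive approximation: the extended ideals of a decreasing sequence of
   taut ideals shrink to 0, so the corrections converge. *)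
Lemma lc_expand_surj (X : choiceType) I (u : lincomb S X) :
  taut_ideal I -> lc_in (extended_ideal I) u ->
  exists2 a, lc_in I a & lc_expand a = u.
Proof.
move=> tI Iu; have [E [E0 tE ES Ebase]] := taut_ideal_seq tI.
have Emon m n : (m <= n)%N -> E n `<=` E m.
  move=> /subnK <-; elim: (n - m)%N => [|k IHk]; first exact: subset_refl.
  by apply: subset_trans IHk; exact: ES.
pose J n := extended_ideal (E n).
have oE n : open_subgroup (E n) by case: (taut_idealP (tE n)).
have oJ n : open_subgroup (J n) by case: (taut_idealP (tE n)).
have rJ n : right_ideal (J n) by case: (tE n) => _ _ _ [].
have /choice[step stepP] (vn : lincomb S X * nat) :
    exists a : lincomb R (lincomb S X), lc_in (J vn.2) vn.1 ->
      lc_in (E vn.2) a /\ lc_in (J vn.2.+1) (vn.1 - lc_expand a).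
  have [Jv|] := pselect (lc_in (J vn.2) vn.1); last by exists 0.
  have [a] := lc_expand_approx (tE _) (oJ vn.2.+1).1 (rJ _) Jv.
  by exists a.
(* [v n] is the error left after the first [n] corrections [a 0], ..., [a n.-1]. *)
pose v := fix v n := if n is m.+1 then v m - lc_expand (step (v m, m)) else u.
pose a n := step (v n, n).
have Jv n : lc_in (J n) (v n).
  by elim: n => [|n IHn]; [rewrite /J E0|exact: (stepP (v n, n) IHn).2].
have Ea n : lc_in (E n) (a n) by exact: (stepP (v n, n) (Jv n)).1.
have vE n : v n = u - lc_expand (\sum_(m < n) a m).
  elim: n => [|n IHn]; first by rewrite big_ord0 raddf0 subr0.
  by rewrite big_ord_recr raddfD /= opprD addrA -IHn.
have a0 w : cvg0_family (fun n => coef (a n) w).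
  move=> U /open_subgroup_nbhs0/Ebase[n nU].
  apply: sub_finite_set (finite_II n) => m /= nUm.
  rewrite ltnNge; apply/negP => nm; apply: nUm; apply: nU.
  by apply: (Emon n m) => //; exact: Ea.
(* All corrections from index [n] on have coefficients in [E n], so the tail of the series lies
   there too. *)
have sum_mod n w :
    E n (infsum (fun m => coef (a m) w) - coef (\sum_(m < n) a m) w).
  pose A := [fset m | m in iota 0 n]%fset.
  rewrite lc_coef_sum -(big_mkord predT (fun m => coef (a m) w)).
  have -> : \sum_(0 <= m < n) coef (a m) w = \sum_(m <- A) coef (a m) w.
    apply: perm_big; rewrite /index_iota subn0; apply: uniq_perm => [||m].
    - exact: iota_uniq.
    - exact: fset_uniq.
    - by rewrite inE.
  apply: infsum_mod => // m; rewrite !inE mem_iota add0n /= -leqNgt => nm.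
  by apply: (Emon n m) => //; exact: Ea.
(* Modulo [E n] the limit agrees with a finite sum of corrections, whose coefficients converge to
   zero. *)
have b0 : cvg0_family (fun w => infsum (fun m => coef (a m) w)).
  move=> U /open_subgroup_nbhs0/Ebase[n nU].
  apply: sub_finite_set (coef_cvg0 (\sum_(m < n) a m) (oE n)) => w /= nUw Ew.
  apply: nUw; apply: nU; rewrite -[infsum _](subrK (coef (\sum_(m < n) a m) w)).
  exact: open_subgroupD.
exists (Lincomb b0).
  by move=> w; have := sum_mod 0%N w; rewrite big_ord0 E0 subr0.
apply: lincombP => x.
apply: eq_mod_open => U /open_subgroup_ideal_sub[K [oK iK KU]].
have oV := preimage_open_subgroup cf (open_subgroup_ideal oK iK).
have [n nV] := Ebase _ (open_subgroup_nbhs0 oV).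
apply: KU; apply: (extended_ideal_min (I := E n) oK iK.1).
  by move=> _ [r Er <-]; exact: nV.
(* The expansion of the tail and the error [v n] both have coefficients in [J n]; their difference
   is the expansion of the limit minus [u]. *)
have Jb : lc_in (J n) (lc_expand (Lincomb b0 - \sum_(m < n) a m)).
  by apply: (lc_in_expand (I := E n)) => // w; exact: sum_mod.
have := open_subgroupB (oJ n) (Jb x) (Jv n x).
rewrite -lc_coefB vE raddfB opprB addrA subrK lc_coefB.
exact.
Qed.

End Taut.

(** * Extensionality principles *)

(** The agreement set is a subgroup, and by [lc_split] the two tested classes generate
    everything. *)
Lemma lincomb_ext (R : completeLinearRingType) (X : choiceType) (V : zmodType)
    (U : set R) (g h : lincomb R X -> V) :
  zmod_morphism g -> zmod_morphism h -> open_subgroup U ->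
  (forall r, lc_in U r -> g r = h r) ->
  (forall a x, g (a *: lc_unit R x) = h (a *: lc_unit R x)) -> g =1 h.
Proof.
move=> gB hB oU ghU ghx r.
pose E := [set s | g s = h s].
have sE : subgroup E.
  split; last by move=> s t Es Et; rewrite /E /= gB hB Es Et.
  by rewrite /E /= -(subrr 0) gB hB !subrr.
have [A UA] := lc_split r oU.
suff : E r by [].
rewrite -[r](subrK (\sum_(x <- A) coef r x *: lc_unit R x)).
apply: subgroupD => //; first exact: ghU.
by apply: subgroup_sum => // x; exact: ghx.
Qed.

Lemma lc_map_id (R : completeLinearRingType) (X : choiceType) (r : lincomb R X) :
  lc_map id r = r.
Proof.
apply: lincombP => y /=; rewrite (@infsum_single _ _ _ y).
- by rewrite /patch mem_set.
- exact/cvg0_restrict/coef_cvg0.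
- by move=> x /eqP xy; rewrite /patch memNset.
Qed.

Lemma contra_homP (R : completeLinearRingType) (P Q : contramodule R)
    (g h : contra_hom P Q) : g =1 h -> g = h.
Proof.
case: g h => [g gP] [h hP] /= /funext gh; case: h / gh hP => hP.
by congr ContraHom; exact: Prop_irrelevance.
Qed.

(** * Discrete contramodules; from full faithfulness to the proepimorphism *)

Section DiscreteContramodule.
Variables (S : completeLinearRingType) (T : pzRingType) (k : {rmorphism S -> T}).
Variable J : set S.
Hypotheses (oJ : open J) (iJ : two_sided_ideal J).
Hypothesis kJ : forall s, J s -> k s = 0.

Let sJ : open_subgroup J := open_subgroup_ideal oJ iJ.

(** The action of [S] on [T] through [k]. Terms with coefficient in [J] vanish because [k] kills
    [J], so only finitely many remain. *)
Definition discrete_pi (r : lincomb S T) : T :=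
  \sum_(t <- fset_set [set t | ~ J (coef r t)]) k (coef r t) * t.

(** Freedom in choosing [A] allows several combinations to be summed over the same finite set. *)
Lemma discrete_piE (A : {fset T}) (r : lincomb S T) :
  (forall t, t \notin A -> J (coef r t)) ->
  discrete_pi r = \sum_(t <- A) k (coef r t) * t.
Proof.
move=> AJ; have fin := coef_cvg0 r sJ.
pose B := fset_set [set t | ~ J (coef r t)].
rewrite /discrete_pi [RHS](big_fsetID _ (fun t => t \in B)) /=.
rewrite [X in _ = _ + X]big_seq [X in _ = _ + X]big1 ?addr0.
  apply: eq_fbigl => t; rewrite !inE /= andbC in_fset_set //.
  have [tA|tA] := boolP (t \in A); first by rewrite andbT.
  by rewrite andbF memNset //=; move/(_ (AJ t tA)).
move=> t; rewrite !inE /= in_fset_set // => /andP[_].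
by rewrite notin_setE /= => /contrapT/kJ ->; rewrite mul0r.
Qed.

Lemma discrete_piB : zmod_morphism discrete_pi.
Proof.
move=> r s.
have [A rA] := cvg0_fset (coef_cvg0 r) sJ.
have [B sB] := cvg0_fset (coef_cvg0 s) sJ.
rewrite !(@discrete_piE (A `|` B)%fset).
- by rewrite -sumrB; apply: eq_bigr => t _; rewrite lc_coefB rmorphB mulrBl.
- by move=> t; rewrite inE negb_or => /andP[_ /sB].
- by move=> t; rewrite inE negb_or => /andP[/rA].
- move=> t; rewrite inE negb_or => /andP[/rA ? /sB ?].
  exact: open_subgroupB.
Qed.

Lemma discrete_pi_in r : lc_in J r -> discrete_pi r = 0.
Proof. by move=> Jr; rewrite (@discrete_piE fset0) ?big_seq_fset0. Qed.

Lemma discrete_piZ a r : discrete_pi (a *: r) = k a * discrete_pi r.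
Proof.
have [A rA] := cvg0_fset (coef_cvg0 r) sJ.
rewrite !(@discrete_piE A) // => [|t tA]; last by apply: iJ.2; exact: rA.
by rewrite mulr_sumr; apply: eq_bigr => t _; rewrite mulrA -rmorphM.
Qed.

Lemma discrete_pi_unit t : discrete_pi (lc_unit S t) = t.
Proof.
rewrite (@discrete_piE [fset t]%fset) => [|u].
  by rewrite big_seq_fset1 /= eqxx rmorph1 mul1r.
by rewrite inE /= => /negbTE ->; case: sJ => _ [].
Qed.

Lemma discrete_pi_assoc (s : lincomb S (lincomb S T)) :
  discrete_pi (lc_map discrete_pi s) = discrete_pi (lc_mult s).
Proof.
move: s; apply: (lincomb_ext (U := J)) => //.
- by move=> r s; rewrite raddfB discrete_piB.
- by move=> r s; rewrite raddfB discrete_piB.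
- move=> s Js; rewrite !discrete_pi_in //; first exact: lc_in_mult iJ.1 _.
  exact: lc_in_map.
- move=> a r.
  by rewrite lc_map_scale_unit lc_mult_scale_unit !discrete_piZ discrete_pi_unit.
Qed.

Definition discrete_contra : contramodule S :=
  Contramodule discrete_pi_unit discrete_pi_assoc.

(** The single open ideal [J] already acts by zero. *)
Lemma discrete_separated : Defs.separated discrete_contra.
Proof.
have z : contra0 discrete_contra = 0.
  by apply: discrete_pi_in => t; case: sJ => _ [].
apply/seteqP; split=> [t /(_ J (conj oJ iJ.1))[r Jr <-]|_ ->].
  exact: etrans (discrete_pi_in Jr) (esym z).
by move=> I [_ [[I0 _] _]]; exists (lc_zero S T).
Qed.

Definition discrete_separ : separ S := Separ discrete_separated.

End DiscreteContramodule.

Lemma fully_faithful_proepi (R S : completeLinearRingType)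
    (f : {rmorphism R -> S}) (cf : continuous f) :
  separ_restrict_fully_faithful cf -> proepimorphism f.
Proof.
move=> ff I J oI oJ fIJ T h k hk x.
pose hS : {rmorphism S -> T} := h \o quotring_pi J.
pose kS : {rmorphism S -> T} := k \o quotring_pi J.
have piJ s : ideal2_set J s -> quotring_pi J s = 0.
  move=> Js; rewrite -(rmorph0 (quotring_pi J)).
  by apply/quotring_piP/asboolP; rewrite subr0.
have hJ s : ideal2_set J s -> hS s = 0.
  by move=> Js; rewrite /hS /= piJ // rmorph0.
have kJ s : ideal2_set J s -> kS s = 0.
  by move=> Js; rewrite /kS /= piJ // rmorph0.
have hkf r : hS (f r) = kS (f r).
  by have := hk (quotring_pi I r); rewrite /= !quotmap_pi.
pose P := discrete_separ oJ (ideal2P J) hJ.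
pose Q := discrete_separ oJ (ideal2P J) kJ.
have idP (r : lincomb R T) :
    id (@contra_pi R (separ_restrict cf P) r) =
    @contra_pi R (separ_restrict cf Q) (lc_map id r).
  rewrite lc_map_id /= /restrict_pi /= /discrete_pi.
  by apply: eq_bigr => t _; congr (_ * _); exact: hkf.
have [g _ gK] := ff P Q.
pose i : contra_hom (separ_restrict cf P) (separ_restrict cf Q) :=
  @ContraHom R (separ_restrict cf P) (separ_restrict cf Q) id idP.
(* Restriction keeps the underlying function, so the lift of the identity is again the identity. *)
have gE t : g i t = t.
  by rewrite -[RHS]/(i t) -[in RHS](gK i).
rewrite -[x]quotring_reprK; set s := repr x.
(* The two sides evaluate to [hS s * 1] and [kS s * 1]. *)
have := contra_funP (g i) (s *: lc_unit S (1 : T)).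
rewrite gE lc_map_scale_unit gE /=.
by rewrite !discrete_piZ ?discrete_pi_unit ?mulr1 //; exact: ideal2P.
Qed.

(** * The quotient of a contramodule by an open ideal's action, as a module *)

Section ContraQuotient.
Variables (S : completeLinearRingType) (J : ideal2 S) (P : contramodule S).
Implicit Types r s : lincomb S P.

Definition contra_quot_mem : lincomb S P -> bool :=
  fun r => `[< contra_act J P (contra_pi r) >].

Lemma contra_quot_zmod_closed : zmod_closed contra_quot_mem.
Proof.
have [J0 JB] := contra_act_subgroup P (ideal2P J).1.1.
split; first exact/asboolP.
by move=> r s /asboolP Jr /asboolP Js; apply/asboolP; exact: JB.
Qed.

HB.instance Definition _ := GRing.isZmodClosed.Build (lincomb S P)
  contra_quot_mem contra_quot_zmod_closed.

(* The quotient of P by J P, presented as a quotient of the free contramodule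
   because the additive structure of P is only implicit. *)
Definition contra_quot :=
  Quotient.quot (GRing.ZmodClosed.clone (lincomb S P) contra_quot_mem _).

HB.instance Definition _ := GRing.Zmodule.on contra_quot.
HB.instance Definition _ := EqQuotient.on contra_quot.
HB.instance Definition _ := ZmodQuotient.on contra_quot.

Definition contra_quot_pi r : contra_quot := \pi_contra_quot%qT r.

Lemma contra_quot_piP r s :
  reflect (contra_quot_pi r = contra_quot_pi s)
          `[< contra_act J P (contra_pi (r - s)) >].
Proof.
have -> : `[< contra_act J P (contra_pi (r - s)) >] =
    (contra_quot_pi r == contra_quot_pi s).
  by rewrite /contra_quot_pi -Quotient.idealrBE.
exact: eqP.
Qed.

Lemma contra_quot_reprK m : contra_quot_pi (repr m) = m.
Proof. exact: reprK. Qed.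

Lemma contra_quot_piD r s :
  contra_quot_pi (r + s) = contra_quot_pi r + contra_quot_pi s.
Proof. by rewrite /contra_quot_pi !piE. Qed.

Lemma contra_quot_piB : zmod_morphism contra_quot_pi.
Proof. by move=> r s; rewrite /contra_quot_pi !piE. Qed.

Lemma contra_quot_pi0 r : contra_act J P (contra_pi r) -> contra_quot_pi r = 0.
Proof.
move=> Jr; have <- : contra_quot_pi 0 = 0.
  by rewrite -(subrr (0 : lincomb S P)) contra_quot_piB subrr.
by apply/contra_quot_piP/asboolP; rewrite subr0.
Qed.

Lemma contra_quot_pi_in r : lc_in J r -> contra_quot_pi r = 0.
Proof. by move=> Jr; apply: contra_quot_pi0; exists r. Qed.

(** The class of [r] depends only on its value in [P], as both combinations have the same
    [contra_pi]; this justifies reading the quotient as one of [P]. *)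
Lemma contra_quot_pi_unit r :
  contra_quot_pi (lc_unit S (contra_pi r)) = contra_quot_pi r.
Proof.
have sJ := contra_act_subgroup P (ideal2P J).1.1.
apply/contra_quot_piP/asboolP.
rewrite (contra_pi_congB (contra_unit (contra_pi r)) (erefl (contra_pi r))).
by rewrite subrr; case: sJ.
Qed.

Definition contra_quot_scale (b : quotring J) (m : contra_quot) : contra_quot :=
  contra_quot_pi (repr b *: repr m).

(** Independence of both representatives: changing the scalar gives an error with coefficients in
    [J], a right ideal; changing the vector gives one that stays in [J P] because [J] is also a left
    ideal. *)
Lemma contra_quot_scaleE a r : contra_quot_pi (a *: r) =
  contra_quot_scale (quotring_pi J a) (contra_quot_pi r).
Proof.
have iJ := ideal2P J; have sJ := contra_act_subgroup P iJ.1.1.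
apply/contra_quot_piP/asboolP; set a' := repr _; set r' := repr _.
have -> : a *: r - a' *: r' = (a - a') *: r + a' *: (r - r').
  by rewrite scalerBl scalerBr addrA subrK.
apply: (subgroupD sJ).
  exists ((a - a') *: r) => //; apply: lc_inZl iJ.1 _.
  by apply/asboolP/quotring_piP; rewrite quotring_reprK.
apply: contra_actZ => //.
by apply/asboolP/contra_quot_piP; rewrite contra_quot_reprK.
Qed.

Lemma contra_quot_scaleA a b m :
  contra_quot_scale a (contra_quot_scale b m) = contra_quot_scale (a * b) m.
Proof.
rewrite -[a]quotring_reprK -[b]quotring_reprK -[m]contra_quot_reprK.
by rewrite -rmorphM -!contra_quot_scaleE scalerA.
Qed.

Lemma contra_quot_scale1 : left_id 1 contra_quot_scale.
Proof.
move=> m; rewrite -[m]contra_quot_reprK -(rmorph1 (quotring_pi J)).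
by rewrite -contra_quot_scaleE scale1r.
Qed.

Lemma contra_quot_scaleDr : right_distributive contra_quot_scale +%R.
Proof.
move=> a m n; rewrite -[a]quotring_reprK.
rewrite -[m]contra_quot_reprK -[n]contra_quot_reprK.
by rewrite -contra_quot_piD -!contra_quot_scaleE scalerDr contra_quot_piD.
Qed.

Lemma contra_quot_scaleDl m : {morph contra_quot_scale^~ m : a b / a + b}.
Proof.
move=> a b; rewrite -[m]contra_quot_reprK.
rewrite -[a]quotring_reprK -[b]quotring_reprK.
by rewrite -rmorphD -!contra_quot_scaleE scalerDl contra_quot_piD.
Qed.

HB.instance Definition _ := GRing.Zmodule_isLmodule.Build (quotring J) contra_quot
  contra_quot_scaleA contra_quot_scale1 contra_quot_scaleDr contra_quot_scaleDl.

Lemma contra_quot_piZ a r :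
  contra_quot_pi (a *: r) = quotring_pi J a *: contra_quot_pi r.
Proof. exact: contra_quot_scaleE. Qed.

End ContraQuotient.

(** * From the proepimorphism to full faithfulness *)

Section RestrictedHom.
Variables (R S : completeLinearRingType) (f : {rmorphism R -> S}).
Hypotheses (cf : continuous f) (R_countable : countable_nbhs0_base R)
  (f_taut : strongly_right_taut f) (f_epi : proepimorphism f).
Variables (P Q : contramodule S).
Variable h : contra_hom (Defs.restrict cf P) (Defs.restrict cf Q).

(** A difference is a combination with coefficients 1 and -1, which come from [R], so [h] respects
    it. *)
Lemma restricted_hom_piB (r s : lincomb S P) :
  h (@contra_pi S P (r - s)) =
  contra_pi
    (lc_unit S (h (@contra_pi S P r)) - lc_unit S (h (@contra_pi S P s))).
Proof.
rewrite contra_piB.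
have /= := contra_funP h
  (lc_unit R (@contra_pi S P r) - lc_unit R (@contra_pi S P s)).
by rewrite /restrict_pi lc_mapB !lc_map_unit !lc_scalarB !lc_scalar_unit.
Qed.

Lemma restricted_hom_piZ a (r : lincomb S P) :
  h (@contra_pi S P (f a *: r)) =
  contra_pi (f a *: lc_unit S (h (@contra_pi S P r))).
Proof.
have scalarZ (X : choiceType) (x : X) :
    lc_scalar cf (a *: lc_unit R x) = f a *: lc_unit S x.
  by apply: lincombP => y /=; rewrite rmorphM rmorph_nat.
rewrite contra_piZ; have /= := contra_funP h (a *: lc_unit R (@contra_pi S P r)).
by rewrite lc_map_scale_unit /restrict_pi !scalarZ.
Qed.

Section Taut.
Variable I : set R.
Hypothesis tI : taut_ideal f I.

Let iI : two_sided_ideal I. Proof. by case: tI. Qed.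
Let iJ : two_sided_ideal (extended_ideal f I). Proof. by case: tI. Qed.
Let J := Ideal2 iJ.

(** By [lc_expand_surj], [p] is the value of a combination over [R] with coefficients in [I], and
    [h] preserves such values. *)
Lemma restricted_hom_act (p : P) :
  contra_act J P p -> contra_act J Q (h p).
Proof.
move=> [u Ju <-].
have [a Ia <-] := lc_expand_surj cf R_countable f_taut tI Ju.
rewrite contra_pi_expand contra_funP.
set b := lc_map h _; exists (lc_scalar cf b) => // q.
apply: image_extended_ideal; exists (coef b q) => //.
have [oI _] := taut_idealP tI.
by move: q; do 2! apply: lc_in_map => //.
Qed.

(** The composite [S[[P]] -> P -> Q -> Q/JQ], which descends to [g] on [P/JP]. *)
Let hq (r : lincomb S P) : contra_quot J Q :=
  contra_quot_pi J (lc_unit S (h (@contra_pi S P r))).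

Let hqB : zmod_morphism hq.
Proof.
by move=> r s; rewrite /hq restricted_hom_piB contra_quot_pi_unit contra_quot_piB.
Qed.

Let hq_act r : contra_act J P (contra_pi r) -> hq r = 0.
Proof.
move=> Jr; apply: contra_quot_pi0; rewrite contra_unit.
exact: restricted_hom_act.
Qed.

Let g (m : contra_quot J P) : contra_quot J Q := hq (repr m).

Let g_pi r : g (contra_quot_pi J r) = hq r.
Proof.
apply/subr0_eq; rewrite /g -hqB; apply: hq_act.
by apply/asboolP/contra_quot_piP; rewrite contra_quot_reprK.
Qed.

(** Both sides are additive and vanish when the coefficients lie in [J]; on a scaled unit the claim
    is the linearity of [g] over [S/J], obtained from that over [R/I]. *)
Lemma restricted_hom_mod (r : lincomb S P) :
  contra_quot_pi J (lc_unit S (h (@contra_pi S P r))) =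
  contra_quot_pi J (lc_map h r).
Proof.
have fIJ : f @` Ideal2 iI `<=` J by exact: image_extended_ideal.
have [oI oJ] := taut_idealP tI.
have gB : zmod_morphism g.
  move=> m n; rewrite -[m]contra_quot_reprK -[n]contra_quot_reprK.
  by rewrite -contra_quot_piB !g_pi hqB.
have gA a m : g (induced_map fIJ a *: m) = induced_map fIJ a *: g m.
  rewrite -[a]quotring_reprK -[m]contra_quot_reprK /= (quotmap_pi fIJ).
  rewrite -contra_quot_piZ !g_pi /hq.
  by rewrite restricted_hom_piZ contra_quot_pi_unit contra_quot_piZ.
have gJ := ring_epi_linear gB (@f_epi (Ideal2 iI) J oI.1 oJ.1 fIJ) gA.
move: r; apply: (lincomb_ext (U := J)) => //.
- by move=> r s; rewrite raddfB contra_quot_piB.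
- move=> r Jr; rewrite [RHS]contra_quot_pi_in; last exact: lc_in_map oJ Jr.
  by apply: hq_act; exists r.
- move=> a p; rewrite lc_map_scale_unit -[LHS]g_pi !contra_quot_piZ gJ g_pi /hq.
  by rewrite contra_unit.
Qed.

End Taut.

Lemma restricted_hom_linear (r : lincomb S P) : Defs.separated Q ->
  h (@contra_pi S P r) = contra_pi (lc_map h r).
Proof.
move=> sQ; apply: (@separated_eq S Q) => // U oU rU.
have [I tI IU] := taut_ideal_extended_sub cf f_taut oU rU.
(* Replacing [lc_map h r] by the unit of its value gives the difference the shape required by
   [separated_eq]. *)
have := restricted_hom_mod tI r; rewrite -(contra_quot_pi_unit _ (lc_map h r)).
by move=> /contra_quot_piP/asboolP[s Js <-]; exists s => // q; exact: (IU _ (Js q)).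
Qed.

End RestrictedHom.

Theorem proposition7p7 (R S : completeLinearRingType)
    (f : {rmorphism R -> S}) (f_cont : continuous f)
    (R_countable : countable_nbhs0_base R)
    (S_countable : countable_nbhs0_base S)
    (f_taut : strongly_right_taut f) :
  separ_restrict_fully_faithful f_cont <-> proepimorphism f.
Proof.
split=> [|f_epi P Q]; first exact: fully_faithful_proepi.
(* The inverse keeps the function and only upgrades its compatibility from [R] to [S]. *)
exists (fun h : contra_hom (separ_restrict f_cont P) (separ_restrict f_cont Q) =>
  @ContraHom S P Q h (fun r =>
    restricted_hom_linear R_countable f_taut f_epi h r (separP Q))).
- by move=> h; exact: contra_homP.
- by move=> h; exact: contra_homP.
Qed.
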